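(* Let $X$ be a metrizable space that is non-degenerate, connected and locally path-connected. Let $\operatorname{Fin}(X)$ be the hyperspace of non-empty finite subsets of $X$ endowed with the Vietoris topology. Then $\operatorname{Fin}(X)$ has the compact strong $Z$-set property, i.e. every compact subset of $\operatorname{Fin}(X)$ is a strong $Z$-set in $\operatorname{Fin}(X)$.
   Context: Non-degenerate means having more than one point. Maps are continuous. For maps $f,g : Y \to Z$ and an open cover $\mathcal{U}$ of $Z$, $f$ is $\mathcal{U}$-close to $g$ if for each $y \in Y$ there is $U \in \mathcal{U}$ containing both $f(y)$ and $g(y)$. A closed subset $A$ of a space $Y$ is a strong $Z$-set in $Y$ if for each open cover $\mathcal{U}$ of $Y$ there exists a continuous map $f : Y \to Y$ that is $\mathcal{U}$-close to the identity map on $Y$ and such that the closure of $f(Y)$ in $Y$ is disjoint from $A$. For any metric $d$ inducing the topology of $X$, the Vietoris topology on $\operatorname{Fin}(X)$ is induced by the Hausdorff metric $d_H(A,B) = \inf\{r > 0 \mid A \subset N_d(B,r),\ B \subset N_d(A,r)\}$, where $N_d(A,r) = \{x \in X \mid \inf_{a\in A} d(x,a) < r\}$. *)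

(* Defs.v *)
(* [R : realType] is the field of real numbers, used for distances and for the
   unit interval. *)
From HB Require Import structures.
From mathcomp Require Import all_boot all_order all_algebra finmap.
From mathcomp Require Import all_classical all_reals.
From mathcomp Require Import topology normedtype.

Set Implicit Arguments.
Unset Strict Implicit.
Unset Printing Implicit Defensive.

Import Order.TTheory GRing.Theory Num.Theory.
Import numFieldNormedType.Exports.
Local Open Scope classical_set_scope.
Local Open Scope ring_scope.

Definition is_metric (R : realType) (T : Type) (d : T -> T -> R) : Prop :=
  [/\ forall x, d x x = 0,
      forall x y, d x y = 0 -> x = y,
      forall x y, d x y = d y x &
      forall x y z, d x z <= d x y + d y z].

Definition induces_topology (R : realType) (T : topologicalType)
    (d : T -> T -> R) : Prop :=
  forall (x : T) (W : set T),
    nbhs x W <-> exists2 e : R, 0 < e & [set y | d x y < e] `<=` W.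

Definition compatible_metric (R : realType) (T : topologicalType)
    (d : T -> T -> R) : Prop :=
  is_metric d /\ induces_topology d.

Definition metrizable (R : realType) (T : topologicalType) : Prop :=
  exists d : T -> T -> R, compatible_metric d.

Definition nondegenerate_space (T : Type) : Prop := exists x y : T, x <> y.

Definition path_connected (R : realType) (T : topologicalType) (V : set T) :
    Prop :=
  forall x y, V x -> V y ->
    exists f : R -> T,
      [/\ {within `[0, 1], continuous f}, f 0 = x, f 1 = y &
          forall t, `[0, 1]%classic t -> V (f t)].

Definition locally_path_connected (R : realType) (T : topologicalType) : Prop :=
  forall (x : T) (U : set T), nbhs x U ->
    exists V : set T, [/\ open V, V x, V `<=` U & path_connected R V].

Definition Fin (X : topologicalType) : Type :=
  set_type [set A : set X | finite_set A /\ A !=set0].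

Definition Fin_set (X : topologicalType) (A : Fin X) : set X := \val A.

HB.instance Definition _ (X : topologicalType) := gen_eqMixin (Fin X).
HB.instance Definition _ (X : topologicalType) := gen_choiceMixin (Fin X).

Definition vietoris_inside (X : topologicalType) (U : set X) : set (Fin X) :=
  [set A | Fin_set A `<=` U].

Definition vietoris_meets (X : topologicalType) (U : set X) : set (Fin X) :=
  [set A | Fin_set A `&` U !=set0].

Definition vietoris_subbase (X : topologicalType) : set (set (Fin X)) :=
  [set vietoris_inside U | U in open] `|` [set vietoris_meets U | U in open].

(* The Vietoris topology.  It does not depend on a choice of metric; that it is
   induced by the Hausdorff metric of any compatible metric on X is
   [Hausdorff_metric_vietoris] below. *)
HB.instance Definition _ (X : topologicalType) :=
  isSubBaseTopological.Build (Fin X) (@vietoris_subbase X) id.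

Definition close_to (Y Z : Type) (U : set (set Z)) (f g : Y -> Z) : Prop :=
  forall y, exists2 V, U V & V (f y) /\ V (g y).

Definition open_cover (Z : topologicalType) (U : set (set Z)) : Prop :=
  U `<=` open /\ cover U id = [set: Z].

Definition strong_Z_set (Y : topologicalType) (A : set Y) : Prop :=
  closed A /\
  forall U : set (set Y), open_cover U ->
    exists f : Y -> Y,
      [/\ continuous f, close_to U f id & closure (range f) `&` A = set0].

Definition compact_strong_Z_set_property (Y : topologicalType) : Prop :=
  forall K : set Y, compact K -> strong_Z_set K.

Definition metric_nbhd (R : realType) (X : Type) (d : X -> X -> R)
    (A : set X) (r : R) : set X :=
  [set x | inf [set d x a | a in A] < r].

Definition Hausdorff_metric (R : realType) (X : topologicalType)
    (d : X -> X -> R) (A B : Fin X) : R :=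
  inf [set r | [/\ 0 < r, Fin_set A `<=` metric_nbhd d (Fin_set B) r &
                   Fin_set B `<=` metric_nbhd d (Fin_set A) r]].

Lemma Fin_set_finite (X : topologicalType) (A : Fin X) :
  finite_set (Fin_set A).
Proof. by have [] := set_mem (svalP A). Qed.

Lemma Fin_set_neq0 (X : topologicalType) (A : Fin X) : Fin_set A !=set0.
Proof. by have [] := set_mem (svalP A). Qed.

Lemma Fin_set_inj (X : topologicalType) : injective (@Fin_set X).
Proof. by move=> A B; exact: val_inj. Qed.

Lemma open_vietoris_inside (X : topologicalType) (U : set X) :
  open U -> open (vietoris_inside U).
Proof.
move=> oU; exists [set vietoris_inside U]; last by rewrite bigcup_set1.
move=> _ ->; exists [fset (vietoris_inside U)]%fset.
  by move=> i /fset1P ->; apply/mem_set; left; exists U.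
by apply/seteqP; split => [A /(_ _ (fset11 _))//|A AU i /fset1P ->].
Qed.

Lemma open_vietoris_meets (X : topologicalType) (U : set X) :
  open U -> open (vietoris_meets U).
Proof.
move=> oU; exists [set vietoris_meets U]; last by rewrite bigcup_set1.
move=> _ ->; exists [fset (vietoris_meets U)]%fset.
  by move=> i /fset1P ->; apply/mem_set; right; exists U.
by apply/seteqP; split => [A /(_ _ (fset11 _))//|A AU i /fset1P ->].
Qed.

Lemma vietoris_nbhs_filter (X : topologicalType) (A : Fin X)
    (F : set_system (Fin X)) : Filter F ->
  (forall U, open U -> Fin_set A `<=` U -> F (vietoris_inside U)) ->
  (forall U, open U -> Fin_set A `&` U !=set0 -> F (vietoris_meets U)) ->
  F `=>` nbhs A.
Proof.
move=> FF Fin Fme W; rewrite nbhsE => -[B [[D' D'D <-] [V D'V VA]]] BW.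
have [E ED VE] := D'D _ D'V.
apply: (@filterS _ _ _ V); first by move=> C VC; apply: BW; exists V.
rewrite -VE; apply: filter_bigI => i iE.
have Ai : i A by rewrite /= -VE in VA; exact: VA.
by have /set_mem[[U oU Ui]|[U oU Ui]] := ED i iE; rewrite -Ui in Ai *;
  [exact: Fin|exact: Fme].
Qed.

Section Hausdorff_metric_theory.
Context (R : realType) (X : topologicalType) (d : X -> X -> R).
Context (dX : compatible_metric d).
Local Notation H := (Hausdorff_metric d).

Let dxx x : d x x = 0. Proof. by case: dX => -[]. Qed.
Let d_eq0 x y : d x y = 0 -> x = y. Proof. by case: dX => -[_ + _ _] _; apply. Qed.
Let dC x y : d x y = d y x. Proof. by case: dX => -[]. Qed.
Let d_tri x y z : d x z <= d x y + d y z. Proof. by case: dX => -[]. Qed.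
Let d_nbhs : induces_topology d. Proof. by case: dX. Qed.

Let d_ge0 x y : 0 <= d x y.
Proof.
by rewrite -(@pmulrn_lge0 _ _ 2)// -(dxx x) (le_trans (d_tri x y _))// (dC y) mulr2n.
Qed.

Let finite_uniform (A : set X) (P : X -> R -> Prop) : finite_set A ->
  (forall a s t, s <= t -> P a t -> P a s) ->
  (forall a, A a -> exists2 e, 0 < e & P a e) ->
  exists2 e, 0 < e & forall a, A a -> P a e.
Proof.
move=> /finite_seqP[s ->] Pmono; elim: s => [|a s ih] Ps; first by exists 1.
have [b bs|e e0 Pe] := ih; first by apply: Ps; rewrite /= inE bs orbT.
have [|e' e'0 Pe'] := Ps a; first by rewrite /= inE eqxx.
exists (Num.min e e'); first by rewrite lt_min e0.
move=> b /=; rewrite inE => /predU1P[->|bs].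
  by apply: Pmono Pe'; rewrite ge_min lexx orbT.
by apply: (Pmono _ _ _ _ (Pe _ bs)); rewrite ge_min lexx.
Qed.

Lemma metric_nbhdP (A : set X) r x :
  A !=set0 -> metric_nbhd d A r x <-> exists2 a, A a & d x a < r.
Proof.
move=> [a0 Aa0]; split=> [/inf_lt h|[a Aa xar]].
  by have [|_ [a Aa <-] xar] := h; [exists (d x a0), a0|exists a].
apply: le_lt_trans xar; apply: ge_inf; last by exists a.
by exists 0 => _ [b _ <-].
Qed.

Let Hausdorff_lbound (A B : Fin X) :
  has_lbound [set r | [/\ 0 < r, Fin_set A `<=` metric_nbhd d (Fin_set B) r &
                   Fin_set B `<=` metric_nbhd d (Fin_set A) r]].
Proof. by exists 0 => r [/ltW]. Qed.

Let shrink_radius (A B : Fin X) r : 0 < r ->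
  (forall a, Fin_set A a -> exists2 b, Fin_set B b & d a b < r) ->
  exists2 e, 0 < e &
    forall a, Fin_set A a -> exists2 b, Fin_set B b & d a b < r - e.
Proof.
move=> r0 AB; apply: finite_uniform; first exact: Fin_set_finite.
  move=> a s t st [b Bb abt]; exists b => //.
  by apply: lt_le_trans abt _; rewrite lerB.
move=> a /AB[b Bb abr]; exists ((r - d a b) / 2).
  by rewrite divr_gt0// subr_gt0.
exists b => //; rewrite ltrBrDr -ltrBrDl ltr_pdivrMr//.
by rewrite mulr_natr mulr2n ltrDl subr_gt0.
Qed.

Lemma Hausdorff_metric_ltP (A B : Fin X) r : H A B < r <->
  [/\ 0 < r, forall a, Fin_set A a -> exists2 b, Fin_set B b & d a b < r &
             forall b, Fin_set B b -> exists2 a, Fin_set A a & d b a < r].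
Proof.
have A0 := Fin_set_neq0 A; have B0 := Fin_set_neq0 B.
have key s : 0 < s ->
    (forall a, Fin_set A a -> exists2 b, Fin_set B b & d a b < s) ->
    (forall b, Fin_set B b -> exists2 a, Fin_set A a & d b a < s) ->
    exists2 t, t < s & [/\ 0 < t, Fin_set A `<=` metric_nbhd d (Fin_set B) t &
                   Fin_set B `<=` metric_nbhd d (Fin_set A) t].
  move=> s0 AB BA.
  have [e e0 ABe] := shrink_radius s0 AB; have [f f0 BAf] := shrink_radius s0 BA.
  exists (s - Num.min e f).
    by rewrite ltrBlDr ltrDl lt_min e0.
  split.
  - have [a Aa] := A0; have [b Bb abe] := ABe _ Aa.
    by apply: le_lt_trans (d_ge0 a b) (lt_le_trans abe _); rewrite lerB// ge_min lexx.
  - move=> a /ABe[b Bb abe]; apply/metric_nbhdP => //; exists b => //.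
    by apply: lt_le_trans abe _; rewrite lerB// ge_min lexx.
  - move=> b /BAf[a Aa abe]; apply/metric_nbhdP => //; exists a => //.
    by apply: lt_le_trans abe _; rewrite lerB// ge_min lexx orbT.
have [u Su] : exists u, [/\ 0 < u,
    Fin_set A `<=` metric_nbhd d (Fin_set B) u &
    Fin_set B `<=` metric_nbhd d (Fin_set A) u].
  suff [t [t0 AB BA]] : exists t, [/\ 0 < t,
      forall a, Fin_set A a -> exists2 b, Fin_set B b & d a b < t &
      forall b, Fin_set B b -> exists2 a, Fin_set A a & d b a < t].
    by have [u _ Su] := key _ t0 AB BA; exists u.
  have bnd (C : Fin X) x :
      exists2 e, 0 < e & forall c, Fin_set C c -> d c x < e^-1.
    have [||c _|e e0 Ce] := @finite_uniform (Fin_set C) (fun c e => d c x * e < 1).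
    - exact: Fin_set_finite.
    - by move=> c s t st; apply: le_lt_trans; rewrite ler_wpM2l.
    - exists (d c x + 1)^-1; first by rewrite invr_gt0 ltr_wpDl.
      by rewrite ltr_pdivrMr ?mul1r ?ltrDl// ltr_wpDl.
    - by exists e => // c /Ce; rewrite -ltr_pdivlMr// div1r.
  have [a0 Aa0] := A0; have [b0 Bb0] := B0.
  have [e e0 Ae] := bnd A b0; have [f f0 Bf] := bnd B a0.
  exists (Num.max e^-1 f^-1); split.
  - by rewrite lt_max invr_gt0 e0.
  - by move=> a /Ae h; exists b0 => //; rewrite lt_max h.
  - by move=> b /Bf h; exists a0 => //; rewrite lt_max h orbT.
split=> [/inf_lt h|[r0 AB BA]]; last first.
  have [t tr St] := key _ r0 AB BA.
  by apply: le_lt_trans tr; apply: ge_inf => //; exact: Hausdorff_lbound.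
have [|s [s0 AB BA] sr] := h; first by exists u.
split; first exact: lt_trans sr.
- move=> a /AB/metric_nbhdP-/(_ B0)[b Bb abs]; exists b => //.
  exact: lt_trans sr.
- move=> b /BA/metric_nbhdP-/(_ A0)[a Aa abs]; exists a => //.
  exact: lt_trans sr.
Qed.

Lemma Hausdorff_metric_is_metric : is_metric H.
Proof.
have H_gt0 A B r : H A B < r -> 0 < r by move=> /Hausdorff_metric_ltP[].
have H_ge0 A B : 0 <= H A B.
  by rewrite leNgt; apply/negP => /H_gt0; rewrite ltxx.
have HC A B r : H A B < r -> H B A < r.
  by move=> /Hausdorff_metric_ltP[r0 AB BA]; apply/Hausdorff_metric_ltP; split.
have H0 A B : H A B = 0 -> Fin_set A `<=` Fin_set B.
  move=> AB0 a Aa; apply: contrapT => Ba.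
  have [||b Bb|e e0 Be] := @finite_uniform (Fin_set B) (fun b e => e <= d a b).
  - exact: Fin_set_finite.
  - by move=> b s t; exact: le_trans.
  - exists (d a b) => //; rewrite lt_neqAle d_ge0 andbT eq_sym.
    by apply/eqP => /d_eq0 ab; apply: Ba; rewrite ab.
  - have : H A B < e by rewrite AB0.
    move=> /Hausdorff_metric_ltP[_ /(_ _ Aa)[b Bb abe] _].
    by have := Be _ Bb; rewrite leNgt abe.
have HE A B : H A B = H B A.
  by apply/eqP; rewrite eq_le; apply/andP; split; rewrite leNgt;
    apply/negP => /HC; rewrite ltxx.
split.
- move=> A; apply/eqP; rewrite eq_le H_ge0 andbT; apply/ler_addgt0Pl => e e0.
  rewrite addr0; apply/ltW/Hausdorff_metric_ltP; split => //.
  + by move=> a Aa; exists a => //; rewrite dxx.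
  + by move=> a Aa; exists a => //; rewrite dxx.
- move=> A B AB; apply/Fin_set_inj/seteqP.
  by split; apply: H0; rewrite // HE.
- exact: HE.
- move=> A B C; apply/ler_addgt0Pl => e e0.
  have lth r : r < r + e / 2 by rewrite ltrDl divr_gt0.
  have /Hausdorff_metric_ltP[s0 AB BA] := lth (H A B).
  have /Hausdorff_metric_ltP[t0 BC CB] := lth (H B C).
  rewrite addrC [e]splitr addrACA; apply/ltW/Hausdorff_metric_ltP; split.
  + by rewrite addr_gt0.
  + move=> a /AB[b /BC[c Cc bc] ab]; exists c => //.
    by apply: le_lt_trans (d_tri a b c) _; rewrite ltrD.
  + move=> c /CB[b /BA[a Aa ba] cb]; exists a => //.
    by apply: le_lt_trans (d_tri c b a) _; rewrite addrC ltrD.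
Qed.

Lemma Hausdorff_metric_vietoris : induces_topology H.
Proof.
have oball x e : open [set y | d x y < e].
  rewrite openE => y /= xye; apply/d_nbhs.
  exists (e - d x y); first by rewrite subr_gt0.
  move=> z /= yz; apply: le_lt_trans (d_tri x y z) _.
  by rewrite -ltrBrDl.
have Uball (U : set X) x : open U -> U x ->
    exists2 e, 0 < e & [set y | d x y < e] `<=` U.
  by rewrite openE => oU /oU/d_nbhs.
move=> A W; split; last first.
  case=> e e0 AW.
  have e20 : 0 < e / 2 by rewrite divr_gt0.
  pose U := \bigcup_(a in Fin_set A) [set y | d a y < e].
  pose M := \bigcap_(a in Fin_set A) vietoris_meets [set y | d a y < e].
  suff : nbhs A (vietoris_inside U `&` M).
    apply: filterS => B [BU MB]; apply: AW; apply/Hausdorff_metric_ltP; split=> //.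
      by move=> a Aa; have [b [Bb ab]] := MB _ Aa; exists b.
    by move=> b /BU[a Aa ab]; exists a => //; rewrite dC.
  apply: filterI.
    apply: open_nbhs_nbhs; split.
      by apply: open_vietoris_inside; apply: bigcup_open => a _.
    by move=> a Aa; exists a => //=; rewrite dxx.
  have /finite_fsetP[s As] := Fin_set_finite A.
  rewrite /M As; apply: filter_bigI => a sa.
  have Aa : Fin_set A a by rewrite As.
  apply: open_nbhs_nbhs; split; first exact: open_vietoris_meets.
  by exists a; split => //=; rewrite dxx.
pose F : set_system (Fin X) :=
  [set W | exists2 e, 0 < e & [set B | H A B < e] `<=` W].
have FF : Filter F.
  split; first by exists 1.
  - move=> P Q [e e0 eP] [f f0 fQ]; exists (Num.min e f); rewrite ?lt_min ?e0//.
    by move=> B /=; rewrite lt_min => /andP[/eP PB /fQ QB].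
  - by move=> P Q PQ [e e0 eP]; exists e => // B /eP/PQ.
apply: (@vietoris_nbhs_filter _ A F) => U oU AU.
- have [||a Aa|e e0 Ae] :=
    @finite_uniform (Fin_set A) (fun a e => [set y | d a y < e] `<=` U).
  + exact: Fin_set_finite.
  + by move=> a s t st tU y /= ays; apply: tU; apply: lt_le_trans st.
  + by apply: Uball => //; exact: AU.
  + exists e => // B /Hausdorff_metric_ltP[_ _ BA] b /BA[a Aa ba].
    by apply: (Ae _ Aa); rewrite /= dC.
- case: AU => a [Aa Ua]; have [e e0 aU] := Uball _ _ oU Ua.
  exists e => // B /Hausdorff_metric_ltP[_ /(_ _ Aa)[b Bb ab] _].
  by exists b; split => //; exact: aU.
Qed.

Lemma Fin_metrizable : metrizable R (Fin X).
Proof.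
exists H; split; first exact: Hausdorff_metric_is_metric.
exact: Hausdorff_metric_vietoris.
Qed.


End Hausdorff_metric_theory.

(* Main.v *)
Require Import Defs.
From mathcomp Require Import all_boot all_order all_algebra.
From mathcomp Require Import all_classical all_reals wochoice.
From mathcomp Require Import topology normedtype.
From mathcomp Require Import lra.

(* Given an open cover of Fin(X), every A is joined inside a small ball to a
   finite set P(A) containing points at the distances e, e/2, ..., e/2^M from
   one point, where e = e(A) depends on the cover only and M is free.  A
   locally finite partition of Fin(X) into small pieces, together with short
   paths in Fin(X) between the sets P(C) chosen for neighbouring pieces, yields
   a continuous f : Fin(X) -> Fin(X) close to the identity such that f(A)
   contains P(C) for some C near A.

   No obstruction arises from higher-dimensional simplices of the nerve, because
   f(A) may be a union over several of the paths at once.  If the weights t_i at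
   A are normalised so that the largest is 1, f(A) is the union of the
   gamma_ik(s) with t_i >= 1/4 and t_k >= 1/2, where gamma_ik leads from P_i to
   P_k and s = s(t_i, t_k) is 0 if t_i >= 1/2 and t_k = 1, but 1 as soon as
   t_i <= 1/4 or t_k <= 3/4.

   An element B of a compact set K has finitely many points, so near B every
   element of K is covered by m = #B balls of radius much smaller than
   e(B)/2^m.  By compactness m <= M for a single M, while f(A) contains m + 1
   points that are e/2^m-separated; so f(A) stays away from K. *)

Set Implicit Arguments.
Unset Strict Implicit.
Unset Printing Implicit Defensive.

Import Order.TTheory GRing.Theory Num.Theory.
Import numFieldNormedType.Exports.
Local Open Scope classical_set_scope.
Local Open Scope ring_scope.

(** * Continuity of composites, maxima and minima *)

Lemma comp_continuous (S T U : topologicalType) (f : S -> T) (g : T -> U) :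
  continuous f -> continuous g -> continuous (fun x => g (f x)).
Proof. by move=> cf cg x; exact: (cvg_comp _ _ (cf x) (cg _)). Qed.

Lemma continuous_nbhs (S T : topologicalType) (f : S -> T) :
  continuous f -> forall x U, nbhs (f x) U -> nbhs x (f @^-1` U).
Proof. by move=> cf x U /cf. Qed.

Lemma maxr_continuous (R : realType) (S : topologicalType) (f g : S -> R) :
  continuous f -> continuous g -> continuous (fun x => Num.max (f x) (g x)).
Proof. by move=> cf cg x; exact: (continuous_max (cf x) (cg x)). Qed.

Lemma minr_continuous (R : realType) (S : topologicalType) (f g : S -> R) :
  continuous f -> continuous g -> continuous (fun x => Num.min (f x) (g x)).
Proof. by move=> cf cg x; exact: (continuous_min (cf x) (cg x)). Qed.

(** * Paths parametrised by the whole real line *)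

Section Paths.
Context (R : realType) (T : topologicalType).
Implicit Types (W : set T) (a b c : T).

(** With all of [R] as domain, continuity needs no subspace topology and any continuous real
    function may serve as parameter. *)
Definition joined W a b := exists p : R -> T,
  [/\ continuous p, p 0 = a, p 1 = b & forall s, W (p s)].

Lemma joined_sub W W' a b : W `<=` W' -> joined W a b -> joined W' a b.
Proof. by move=> WW' [p [cp p0 p1 pW]]; exists p; split => // s; exact: WW'. Qed.

Lemma joined_refl W a : W a -> joined W a a.
Proof. by move=> Wa; exists (fun=> a); split => //; exact: cst_continuous. Qed.

Lemma joined_sym W a b : joined W a b -> joined W b a.
Proof.
move=> [p [cp p0 p1 pW]]; exists (fun s => p (1 - s)); split => //.
- apply: (@comp_continuous _ _ _ (fun s : R => 1 - s) p) => // s.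
  by apply: cvgB; [exact: cvg_cst|exact: cvg_id].
- by rewrite subr0.
- by rewrite subrr.
Qed.

Lemma joined_trans W a b c : joined W a b -> joined W b c -> joined W a c.
Proof.
move=> [p [cp p0 p1 pW]] [q [cq q0 q1 qW]].
pose h s := if s <= 2^-1 then p (2 * s) else q (2 * s - 1).
have cp2 : continuous (fun s : R => p (2 * s)).
  apply: (@comp_continuous _ _ _ (fun s : R => 2 * s) p) => //.
  exact: mulrl_continuous.
have cq2 : continuous (fun s : R => q (2 * s - 1)).
  apply: (@comp_continuous _ _ _ (fun s : R => 2 * s - 1) q) => // s.
  by apply: cvgB; [exact: mulrl_continuous|exact: cvg_cst].
exists h; split; last by move=> s; rewrite /h; case: ifP.
- move=> s U hU; change (nbhs s (h @^-1` U)).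
  move: hU; rewrite /h; have [sc|sc|sc] := ltgtP s 2^-1.
  + move=> /(continuous_nbhs cp2) Up; apply: filterS2 Up (lt_nbhsl sc) => u /= Pu us.
    by rewrite (ltW us).
  + move=> /(continuous_nbhs cq2) Uq; apply: filterS2 Uq (lt_nbhsr sc) => u /= Qu us.
    by rewrite leNgt us.
  + move=> Us; have Uq : nbhs (q (2 * s - 1)) U.
      have e : 2 * s = 1 by lra.
      by move: Us; rewrite e subrr q0 p1.
    apply: filterS2 (continuous_nbhs cp2 Us) (continuous_nbhs cq2 Uq) => u /= Pu Qu.
    by case: ifP.
- by rewrite /h mulr0 p0 invr_ge0 ler0n.
- rewrite /h mulr1 leNgt ifF; last by apply/negbTE/negPn; lra.
  by rewrite -[RHS]q1; congr q; lra.
Qed.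

Definition clamp (s : R) : R := Num.max 0 (Num.min s 1).

Lemma clamp_continuous : continuous clamp.
Proof.
apply: (@maxr_continuous _ _ (cst 0)); first exact: cst_continuous.
apply: (@minr_continuous _ _ id (cst 1)); last exact: cst_continuous.
by move=> s; exact: cvg_id.
Qed.

Lemma clamp_le0 s : s <= 0 -> clamp s = 0.
Proof.
by move=> s0; rewrite /clamp min_l ?max_l//; lra.
Qed.

Lemma clamp_ge1 s : 1 <= s -> clamp s = 1.
Proof. by move=> s1; rewrite /clamp min_r// max_r//; lra. Qed.

Lemma clamp_itv s : clamp s \in `[0, 1].
Proof. by rewrite in_itv /= /clamp le_max lexx ge_max ge_min lexx orbT ler01. Qed.

Lemma path_connected_joined W a b :
  path_connected R W -> W a -> W b -> joined W a b.
Proof.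
move=> Wp Wa Wb; have [f [cf f0 f1 fW]] := Wp _ _ Wa Wb.
exists (f \o clamp); split.
- move=> s U Us; have cs : `[0, 1]%classic (clamp s) by exact: clamp_itv.
  have /subspace_continuousP/(_ _ cs U Us) := cf.
  move=> /(continuous_nbhs clamp_continuous); apply: filterS => u; apply.
  exact: clamp_itv.
- by rewrite /= clamp_le0.
- by rewrite /= clamp_ge1.
- by move=> s; apply: fW; exact: clamp_itv.
Qed.

End Paths.

(** * Compatible metrics and Lipschitz functions *)

Section CompatibleMetric.
Context (R : realType) (T : topologicalType) (d : T -> T -> R).
Hypothesis dT : compatible_metric d.

Lemma metric_xx x : d x x = 0. Proof. by case: dT => -[]. Qed.

Lemma metric_eq0 x y : d x y = 0 -> x = y.
Proof. by case: dT => -[_ + _ _] _; apply. Qed.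

Lemma metricC x y : d x y = d y x. Proof. by case: dT => -[]. Qed.

Lemma metric_tri x y z : d x z <= d x y + d y z. Proof. by case: dT => -[]. Qed.

Lemma metric_ge0 x y : 0 <= d x y.
Proof. by have := metric_tri x y x; rewrite metric_xx (metricC y x); lra. Qed.

Lemma near_metric x e : 0 < e -> \forall y \near x, d x y < e.
Proof. by move=> e0; case: dT => _ /(_ x [set y | d x y < e]) [_]; apply; exists e. Qed.

Lemma nbhs_metric x U : nbhs x U -> exists2 e, 0 < e & [set y | d x y < e] `<=` U.
Proof. by case: dT => _ /(_ x U)[]. Qed.

Lemma compatible_metric_hausdorff : hausdorff_space T.
Proof.
move=> x y xy; apply/metric_eq0/eqP; rewrite eq_le metric_ge0 andbT.
rewrite leNgt; apply/negP => d0; have e0 : 0 < d x y / 2 by lra.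
have [z [/= xz yz]] := xy _ _ (near_metric x e0) (near_metric y e0).
by have := metric_tri x z y; rewrite (metricC z y); lra.
Qed.

Lemma lipschitz1_continuous (f : T -> R) :
  (forall x y, f x <= f y + d x y) -> continuous f.
Proof.
move=> fd x; apply/cvgrPdist_lt => e e0; near=> y.
have /= xy : d x y < e by near: y; exact: near_metric.
have := fd x y; have := fd y x; rewrite (metricC y x) => h1 h2.
by rewrite ltr_norml; apply/andP; split; lra.
Unshelve. all: by end_near. Qed.

Lemma sup_lipschitz1 (J : Type) (S : set J) (g : J -> T -> R) (M : R) : S !=set0 ->
  (forall j x, S j -> g j x <= M) ->
  (forall j x y, S j -> g j x <= g j y + d x y) ->
  forall x y, sup [set g j x | j in S] <= sup [set g j y | j in S] + d x y.
Proof.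
move=> [j0 Sj0] gM gd x y; apply: ge_sup; first by exists (g j0 x), j0.
move=> _ [j Sj <-]; apply: le_trans (gd j x y Sj) _; rewrite lerD2r.
apply: ub_le_sup; last by exists j.
by exists M => _ [k Sk <-]; exact: gM.
Qed.


(** * A locally finite partition by Stone's well-ordering argument *)

Section Partition.
Variable r : T -> R.
Hypothesis r_gt0 : forall x, 0 < r x.

Let wo : rel T := sval (well_ordering_principle T).

Let wo_anti a b : wo a b -> wo b a -> a = b.
Proof.
move=> ab ba; have /withinW woT := svalP (well_ordering_principle T).
by apply: (wo_chain_antisymmetric (woT predT)) => //; rewrite -/wo ab.
Qed.

Let firstP x : exists a, d a x < r a /\ forall b, d b x < r b -> wo a b.
Proof.
have [|a [[ax amin] _]] := svalP (well_ordering_principle T) [pred a | d a x < r a].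
  by exists x; rewrite inE metric_xx.
by exists a; split => //; rewrite inE in ax.
Qed.

Let first x : T := sval (cid (firstP x)).

Let first_lt x : d (first x) x < r (first x).
Proof. by have [] := svalP (cid (firstP x)). Qed.

Let first_min x b : d b x < r b -> wo (first x) b.
Proof. by have [_] := svalP (cid (firstP x)); apply. Qed.

(** As in Stone's proof of paracompactness, a point belongs to the least centre whose ball contains
    it, and is sorted by its depth in that ball. *)
Let inside (i : nat * T) c :=
  first c = i.2 /\ forall y, d c y < i.1.+1%:R^-1 -> d i.2 y < r i.2.

(** Each point lies in the ball assigned to the other, so each centre precedes the other in the
    well-order. *)
Let inside_separated n a b x y : inside (n, a) x -> inside (n, b) y ->
  d x y < n.+1%:R^-1 -> a = b.
Proof.
move=> [/= <- xU] [/= <- yU] xy; apply: wo_anti; apply: first_min.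
  by apply: yU; rewrite metricC.
exact: xU.
Qed.

(** The factor 1/3 leaves room for two cones of radius [q n] and two errors of [q n / 2] within the
    separation at scale [n]. *)
Let q n : R := 3^-1 * n.+1%:R^-1.

Let q_gt0 n : 0 < q n. Proof. by rewrite mulr_gt0 ?invr_gt0. Qed.

Let q3 n : n.+1%:R^-1 = 3 * q n.
Proof. by rewrite /q mulrA divff ?mul1r ?pnatr_eq0. Qed.

Let q_le (m n : nat) : (m <= n)%N -> q n <= q m.
Proof. by move=> mn; rewrite /q ler_pM2l ?invr_gt0// lef_pV2 ?posrE// ler_nat ltnS. Qed.

Let q_small e : 0 < e -> exists n, q n < e.
Proof.
move=> e0; exists (Num.truncn (3^-1 / e)).
rewrite ltr_pdivrMr// mulrC -ltr_pdivrMr//; exact: truncnS_gt.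
Qed.

(* [None] contributes the value 0, so that [bump] is nonnegative even when no
   point lies inside. *)
Let cone (i : nat * T) (o : option T) x := if o is Some c then q i.1 - d x c else 0.

Let bump i x :=
  sup [set cone i o x | o in [set o | if o is Some c then inside i c else True]].

Let cone_le i o x : cone i o x <= q i.1.
Proof. by case: o => [c|] /=; [have := metric_ge0 x c; lra|exact: ltW]. Qed.

Let bump_lip i x y : bump i x <= bump i y + d x y.
Proof.
apply: (@sup_lipschitz1 _ _ _ (q i.1)); first by exists None.
  by move=> o z _; exact: cone_le.
move=> [c|] u v _ /=; last by rewrite add0r metric_ge0.
by have := metric_tri v u c; rewrite (metricC v u); lra.
Qed.

Let bump_ge i o x :
  (if o is Some c then inside i c else True) -> cone i o x <= bump i x.
Proof.
move=> io; apply: ub_le_sup; last by exists o.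
by exists (q i.1) => _ [o' _ <-]; exact: cone_le.
Qed.

Let bump_le i x : bump i x <= q i.1.
Proof.
by apply: ge_sup; [exists 0, None|move=> _ [o _ <-]; exact: cone_le].
Qed.

Let bump_gt0 i x : 0 < bump i x -> exists2 c, inside i c & d x c < q i.1.
Proof.
move=> /sup_gt[|_ [[c|] /= ic <-]]; [by exists 0, None| |by rewrite ltxx].
by rewrite subr_gt0 => xc; exists c.
Qed.

Let height x := sup [set bump i x | i in setT].

Let height_ge i x : bump i x <= height x.
Proof.
apply: ub_le_sup; last by exists i.
by exists (q 0) => _ [j _ <-]; rewrite (le_trans (bump_le _ _))// q_le.
Qed.

Let height_lip x y : height x <= height y + d x y.
Proof.
apply: (@sup_lipschitz1 _ _ _ (q 0)); first by exists (0%N, x).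
  by move=> i z _; rewrite (le_trans (bump_le _ _))// q_le.
by move=> i u v _; exact: bump_lip.
Qed.

(** [x] lies inside the ball of [first x] at some scale [n], where its own cone has the value [q n]
    at [x]. *)
Let height_gt0 x : 0 < height x.
Proof.
have e0 : 0 < r (first x) - d (first x) x by rewrite subr_gt0.
have [n qn] : exists n, 3 * q n < r (first x) - d (first x) x.
  have [|n qn] := @q_small ((r (first x) - d (first x) x) / 3); first lra.
  by exists n; lra.
apply: lt_le_trans (height_ge (n, first x) x); apply: lt_le_trans (q_gt0 n) _.
have := @bump_ge (n, first x) (Some x) x; rewrite /= metric_xx subr0; apply.
split => //= y xy; have := metric_tri (first x) x y.
by rewrite q3 in xy; lra.
Qed.

(** Doubling before truncating makes the weight 1 attained, although the supremum [height x] need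
    not be. *)
Let weight i x := Num.min 1 (2 * bump i x / height x).

Let weight_ge i x : 4^-1 <= weight i x -> height x / 8 <= bump i x.
Proof.
rewrite /weight le_min => /andP[_]; rewrite ler_pdivlMr//; lra.
Qed.

(* At the scale [1 / n.+1] at most one [a] has a nonzero bump near a given point,
   and a bump below a fixed fraction of the highest one is ignored, which leaves
   finitely many [n]; [i.2] is the centre of the piece with index [i]. *)
Lemma metric_partition : exists t : nat * T -> T -> R,
  [/\ forall i, continuous (t i),
      forall i x, 4^-1 <= t i x -> d i.2 x < r i.2,
      forall x, exists i, t i x = 1 &
      forall x : T, exists2 J, finite_set J &
        \forall y \near x, forall i, 4^-1 <= t i y -> J i].
Proof.
exists weight; split.
- move=> i; apply: (@minr_continuous _ _ (cst 1)); first exact: cst_continuous.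
  move=> x; apply: cvgM.
    by apply: cvgM; [exact: cvg_cst|exact: (lipschitz1_continuous (bump_lip i))].
  apply: cvgV; first by rewrite gt_eqF.
  exact: (lipschitz1_continuous height_lip).
- move=> i x /weight_ge ix; have := height_gt0 x => hx.
  have [|c [_ ci] xc] := @bump_gt0 i x; first lra.
  by apply: ci; rewrite metricC; apply: lt_trans xc _; rewrite gtr_pMl ?invr_gt0//; lra.
- move=> x; have /sup_gt : height x / 2 < height x by have := height_gt0 x; lra.
  move=> [|_ [i _ <-] ix]; first by exists (bump (0%N, x) x), (0%N, x).
  exists i; rewrite /weight min_l// ler_pdivlMr//; lra.
(* A weight of at least 1/4 near [x] forces a bump above [height x / 16], which no scale beyond [N]
   can reach. *)
- move=> x; have [|N qN] := @q_small (height x / 16).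
    by have := height_gt0 x; lra.
  pose P i := exists2 y, d x y < q N / 2 & 0 < bump i y.
  have Pinj n a b : (n <= N)%N -> P (n, a) -> P (n, b) -> a = b.
    move=> nN [y xy /bump_gt0[c ic yc]] [z xz /bump_gt0[c' ic' zc']].
    apply: (inside_separated ic ic'); have := q_le nN; rewrite /= in yc zc'.
    rewrite q3.
    have := metric_tri c y c'; have := metric_tri y x c'; have := metric_tri x z c'.
    rewrite (metricC c y) (metricC y x); lra.
  exists [set i | (i.1 <= N)%N /\ P i].
    pose g n := (n, xget x [set a | P (n, a)]).
    apply: (sub_finite_set _ (finite_image g (finite_II N.+1))).
    move=> [n a] [/= nN Pa]; exists n => //=; congr pair.
    apply: (Pinj n) => //.
    exact: (@xgetPex _ x [set b | P (n, b)] (ex_intro _ a Pa)).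
  have h0 : 0 < Num.min (q N / 2) (height x / 2).
    have := q_gt0 N; have := height_gt0 x; rewrite lt_min => hx qN0.
    by apply/andP; split; lra.
  apply: filterS (near_metric x h0) => y + i /weight_ge iy.
  rewrite lt_min => /andP[xy xy']; have := height_lip x y.
  have := height_gt0 x; have := bump_le i y => ? ? ?.
  split; last by exists y => //; lra.
  by rewrite leqNgt; apply/negP => /ltnW/q_le; lra.
Qed.

End Partition.

End CompatibleMetric.

Lemma near_finite_set (S : topologicalType) (I : eqType) (J : set I)
    (Q : I -> S -> Prop) (x : S) : finite_set J ->
  (forall j, J j -> \forall y \near x, Q j y) ->
  \forall y \near x, forall j, J j -> Q j y.
Proof.
move=> /finite_seqP[s ->]; elim: s => [|j s ih] Qs; first exact: nearW.
have Qj := Qs j (mem_head _ _).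
have Qs' := ih (fun k ks => Qs k (@mem_behead _ (j :: s) k ks)).
by apply: filterS2 Qj Qs' => y ? ? k; rewrite /= inE => /predU1P[->|]; auto.
Qed.

(** * Continuity of maps into the hyperspace *)

Section FinMaps.
Context (R : realType) (X : topologicalType).

Definition mkFin (A : set X) (h : finite_set A /\ A !=set0) : Fin X :=
  exist _ A (mem_set h).

Lemma continuous_Fin (S : topologicalType) (f : S -> Fin X) :
  (forall x U, open U -> Fin_set (f x) `<=` U ->
    \forall y \near x, Fin_set (f y) `<=` U) ->
  (forall x U, open U -> Fin_set (f x) `&` U !=set0 ->
    \forall y \near x, Fin_set (f y) `&` U !=set0) ->
  continuous f.
Proof.
by move=> fi fm x; apply: vietoris_nbhs_filter => U oU; [exact: fi|exact: fm].
Qed.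

Lemma continuous_Fin_inside (S : topologicalType) (f : S -> Fin X) x U :
  continuous f -> open U -> Fin_set (f x) `<=` U ->
  \forall y \near x, Fin_set (f y) `<=` U.
Proof.
move=> cf oU fU; apply: (continuous_nbhs cf (U := vietoris_inside U)).
apply: open_nbhs_nbhs.
by split => //; exact: open_vietoris_inside.
Qed.

Lemma continuous_Fin_meets (S : topologicalType) (f : S -> Fin X) x U :
  continuous f -> open U -> Fin_set (f x) `&` U !=set0 ->
  \forall y \near x, Fin_set (f y) `&` U !=set0.
Proof.
move=> cf oU fU; apply: (continuous_nbhs cf (U := vietoris_meets U)).
apply: open_nbhs_nbhs.
by split => //; exact: open_vietoris_meets.
Qed.

(** Paths in the hyperspace arise this way from finitely many paths in [X] run at once. *)
Lemma finite_family_continuous (S : topologicalType) (J : eqType) (D : set J)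
    (g : J -> S -> X) (f : S -> Fin X) : finite_set D ->
  (forall j, D j -> continuous (g j)) ->
  (forall s, Fin_set (f s) = [set g j s | j in D]) -> continuous f.
Proof.
move=> finD cg fE; apply: continuous_Fin => x U oU; rewrite fE => fU.
  have : \forall y \near x, forall j, D j -> U (g j y).
    apply: near_finite_set => // j Dj.
    apply: (continuous_nbhs (cg _ Dj)); apply: open_nbhs_nbhs.
    by split => //; apply: fU; exists j.
  by apply: filterS => y Dy; rewrite fE => _ [j Dj <-]; exact: Dy.
case: fU => _ [[j Dj <-] Uj].
have : nbhs x (g j @^-1` U).
  by apply: (continuous_nbhs (cg _ Dj)); exact: open_nbhs_nbhs.
by apply: filterS => y Uy; exists (g j y); rewrite fE; split => //; exists j.
Qed.

(** * Gluing paths over a locally finite family of weights *)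

Section NerveMap.
Context (S : topologicalType) (I : eqType) (t : I -> S -> R).
Hypothesis t_cts : forall i, continuous (t i).
Hypothesis t_max : forall x, exists i, t i x = 1.
Hypothesis t_fin : forall x : S, exists2 J, finite_set J &
  \forall y \near x, forall i, 4^-1 <= t i y -> J i.

Variables (P : I -> Fin X) (p : I -> I -> R -> Fin X).
Hypothesis p_cts : forall i k, continuous (p i k).
Hypothesis p_ends : forall i k x, 4^-1 <= t i x -> 4^-1 <= t k x ->
  p i k 0 = P i /\ p i k 1 = P k.

Let time i k x := clamp (Num.max (4 * (1 - t k x)) (2 - 4 * t i x)).

Let term i k x := p i k (time i k x).

Let active x := [set ik : I * I | 4^-1 <= t ik.1 x /\ 2^-1 <= t ik.2 x].

Let term_cts i k : continuous (term i k).
Proof.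
apply: (@comp_continuous _ _ _ (time i k) (p i k)) => //.
apply: (@comp_continuous _ _ _ _ (@clamp R)); last exact: clamp_continuous.
apply: maxr_continuous => x.
  by apply: cvgM; [exact: cvg_cst|apply: cvgB; [exact: cvg_cst|exact: t_cts]].
by apply: cvgB; [exact: cvg_cst|apply: cvgM; [exact: cvg_cst|exact: t_cts]].
Qed.

(* Leaving out inactive pairs does not destroy continuity: a path that is about
   to be dropped has already arrived at its target. *)
Let term_inactive i k x y : active x (i, k) -> ~ active y (i, k) -> term i k y = P k.
Proof.
move=> [/= xi xk] yik; have k4 : 4^-1 <= t k x by lra.
have [_ <-] := p_ends xi k4; congr p; apply: clamp_ge1.
rewrite le_max; apply/orP; have [yi|yi] := leP 4^-1 (t i y); last by right; lra.
by left; have [yk|] := leP 2^-1 (t k y); [case: yik|lra].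
Qed.

Let term_start i k x : 2^-1 <= t i x -> t k x = 1 -> term i k x = P i.
Proof.
move=> xi xk; have i4 : 4^-1 <= t i x by lra.
have k4 : 4^-1 <= t k x by lra.
have [<- _] := p_ends i4 k4.
by congr p; apply: clamp_le0; rewrite ge_max xk; apply/andP; split; lra.
Qed.

Let active_finite x : finite_set (active x).
Proof.
have [J finJ /nbhs_singleton xJ] := t_fin x.
apply: (sub_finite_set _ (finite_setX finJ finJ)) => -[i k] [/= xi xk].
by split; apply: xJ => //; lra.
Qed.

Let fset x := \bigcup_(ik in active x) Fin_set (term ik.1 ik.2 x).

Let fsetP x : finite_set (fset x) /\ fset x !=set0.
Proof.
split; first by apply: bigcup_finite => // ik _; exact: Fin_set_finite.
have [i xi] := t_max x; have [a ia] := Fin_set_neq0 (term i i x).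
by exists a, (i, i) => //; split; rewrite /= xi; lra.
Qed.

Let f x := mkFin (fsetP x).

Let near_lt i x c : t i x < c -> \forall y \near x, t i y < c.
Proof.
move=> xc; apply: (continuous_nbhs (@t_cts i) (U := [set u | u < c])).
exact: lt_nbhsl.
Qed.

Let near_gt i x c : c < t i x -> \forall y \near x, c < t i y.
Proof.
move=> xc; apply: (continuous_nbhs (@t_cts i) (U := [set u | c < u])).
exact: lt_nbhsr.
Qed.

(* Near [x] the vertex [P k] is the start of the path from [k] to any index of
   weight 1. *)
Let near_vertex k x U : 2^-1 <= t k x -> open U -> Fin_set (P k) `&` U !=set0 ->
  \forall y \near x, fset y `&` U !=set0.
Proof.
move=> xk oU kU; have [J finJ nJ] := t_fin x.
(* An index whose weight at [x] is not 1 keeps away from 1 nearby, so only the indices of weight 1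
   at [x] matter. *)
have nU : \forall y \near x, forall j, J j ->
    t j y = 1 -> Fin_set (term k j y) `&` U !=set0.
  apply: near_finite_set => // j _.
  have [xj|xj|xj] := ltgtP (t j x) 1.
  - by apply: filterS (near_lt xj) => y yj yj1; move: yj; rewrite yj1 ltxx.
  - by apply: filterS (near_gt xj) => y yj yj1; move: yj; rewrite yj1 ltxx.
  - have := @continuous_Fin_meets _ _ x U (@term_cts k j) oU.
    by rewrite (term_start xk xj) => /(_ kU); apply: filterS.
have nk : \forall y \near x, 4^-1 < t k y by apply: near_gt; lra.
apply: filterS3 nJ nU nk => y yJ yU yk; have [j yj] := t_max y.
have [|a [ja Ua]] := yU j _ yj; first by apply: yJ; rewrite yj; lra.
exists a; split => //; exists (k, j) => //=; split; rewrite /= ?yj ?ltW//; lra.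
Qed.

(** For [inside], pairs inactive at [x] stay inactive nearby, as their inequalities fail strictly.
    For [meets], a term that is dropped has reached its vertex [P k], which the map still contains
    up to [U] by [near_vertex]. *)
Lemma nerve_map : exists f : S -> Fin X, [/\ continuous f,
  forall x i, t i x = 1 -> Fin_set (P i) `<=` Fin_set (f x) &
  forall x a, Fin_set (f x) a ->
    exists i k s, [/\ 4^-1 <= t i x, 4^-1 <= t k x & Fin_set (p i k s) a]].
Proof.
exists f; split; last first.
- move=> x a [[i k] [/= xi xk] xa]; exists i, k, (time i k x).
  by split => //; lra.
- move=> x i xi a ia; exists (i, i); first by split; rewrite /= xi; lra.
  by rewrite /= term_start// xi; lra.
apply: continuous_Fin => x U oU fU.
  have [J finJ nJ] := t_fin x.
  have nU : \forall y \near x, forall ik, (J `*` J) ik ->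
      active y ik -> Fin_set (term ik.1 ik.2 y) `<=` U.
    apply: near_finite_set; first exact: finite_setX.
    move=> [i k] _ /=; have [xik|xik] := pselect (active x (i, k)).
      have : \forall y \near x, Fin_set (term i k y) `<=` U.
        apply: continuous_Fin_inside => // a ika.
        by apply: fU; exists (i, k).
      exact: filterS.
    have [xi|xi] := ltP (t i x) 4^-1.
      by apply: filterS (near_lt xi) => y yi [/= + _]; rewrite leNgt yi.
    have [xk|xk] := ltP (t k x) 2^-1.
      by apply: filterS (near_lt xk) => y yk [/= _]; rewrite leNgt yk.
    by case: xik.
  apply: filterS2 nJ nU => y yJ yU a [[i k] yik ika].
  by apply: (yU _ _ yik) => //; case: yik => /= ? ?; split; apply: yJ => //; lra.
case: fU => a [[[i k] xik /= ika] Ua].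
(* If [P k] misses [U], a nearby term meeting [U] cannot have been dropped, since a dropped term
   equals [P k]. *)
have [kU|kU] := pselect (Fin_set (P k) `&` U !=set0).
  by apply: (near_vertex _ oU kU); case: xik.
have : \forall y \near x, Fin_set (term i k y) `&` U !=set0.
  by apply: continuous_Fin_meets => //; exists a.
apply: filterS => y ikU; have [yik|yik] := pselect (active y (i, k)).
  by case: ikU => b [ikb Ub]; exists b; split => //; exists (i, k).
by move: ikU; rewrite (term_inactive xik yik).
Qed.

End NerveMap.

End FinMaps.

(** * Short paths and spread-out points in the hyperspace *)

Section FinGeometry.
Context (R : realType) (X : topologicalType) (d : X -> X -> R).
Hypothesis dX : compatible_metric d.
Local Notation H := (Hausdorff_metric d).

Lemma Hausdorff_compatible : compatible_metric H.
Proof.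
by split; [exact: Hausdorff_metric_is_metric|exact: Hausdorff_metric_vietoris].
Qed.

Hypothesis X_lpc : locally_path_connected R X.

Lemma path_nbhd x e : 0 < e -> exists V : set X,
  [/\ open V, V x, V `<=` [set y | d x y < e] & path_connected R V].
Proof. by move=> e0; apply: X_lpc; exact: near_metric. Qed.

(** Each point of [A] is joined to all points of [B] in its small path-connected neighbourhood; the
    union of these paths moves [A] to [B]. *)
Lemma Fin_near_joined (A : Fin X) e : 0 < e ->
  \forall B \near A, joined R [set C | H A C < e] A B.
Proof.
move=> e0; have [V VP] := choice (fun x => path_nbhd x e0).
have nI : \forall B \near A, Fin_set B `<=` \bigcup_(a in Fin_set A) V a.
  apply: (@continuous_Fin_inside X _ id); first by move=> ?; exact: cvg_id.
    by apply: bigcup_open => a _; case: (VP a).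
  by move=> a Aa; exists a => //; case: (VP a).
have nM : \forall B \near A, forall a, Fin_set A a -> Fin_set B `&` V a !=set0.
  apply: near_finite_set; first exact: Fin_set_finite.
  move=> a Aa; have [oV Va _ _] := VP a.
  apply: (@continuous_Fin_meets X _ id) => //; first by move=> ?; exact: cvg_id.
  by exists a.
apply: filterS2 nI nM => B BI BM.
have /choice[g gP] : forall ab : X * X, exists p : R -> X, V ab.1 ab.2 ->
    [/\ continuous p, p 0 = ab.1, p 1 = ab.2 & forall s, V ab.1 (p s)].
  move=> [a b]; have [_ Va _ Vp] := VP a.
  have [Vb|Vb] := pselect (V a b); last by exists (fun=> a) => /Vb.
  by have [p pP] := path_connected_joined Vp Va Vb; exists p.
pose D := [set ab : X * X | [/\ Fin_set A ab.1, Fin_set B ab.2 & V ab.1 ab.2]].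
have finD : finite_set D.
  apply: (sub_finite_set _ (finite_setX (Fin_set_finite A) (Fin_set_finite B))).
  by move=> ab [].
have DA a : Fin_set A a -> exists2 ab, D ab & ab.1 = a.
  by move=> Aa; have [b [Bb Vb]] := BM a Aa; exists (a, b).
have DB b : Fin_set B b -> exists2 ab, D ab & ab.2 = b.
  by move=> Bb; have [a Aa Vb] := BI b Bb; exists (a, b).
have finP s : finite_set [set g ab s | ab in D] /\ [set g ab s | ab in D] !=set0.
  split; first exact: finite_image.
  by have [a /DA[ab Dab _]] := Fin_set_neq0 A; exists (g ab s), ab.
exists (fun s => mkFin (finP s)); split.
- apply: (@finite_family_continuous X _ _ D g) => // ab [_ _ Vab].
  by case: (gP ab Vab).
- apply/Fin_set_inj/seteqP; split => [_ [ab [Aa _ Vab] <-]|a /DA[ab Dab <-]].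
    by case: (gP ab Vab) => _ ->.
  by exists ab => //; case: Dab => _ _ /gP[].
- apply/Fin_set_inj/seteqP; split => [_ [ab [_ Bb Vab] <-]|b /DB[ab Dab <-]].
    by case: (gP ab Vab) => _ _ ->.
  by exists ab => //; case: Dab => _ _ /gP[].
- move=> s; apply/(Hausdorff_metric_ltP dX); split => //.
    move=> a /DA[ab Dab <-]; exists (g ab s); first by exists ab.
    have [_ _ Vab] := Dab; have [_ _ _ /(_ s) Vg] := gP _ Vab.
    by have [_ _ /(_ _ Vg)] := VP ab.1.
  move=> _ [ab Dab <-]; exists ab.1; first by case: Dab.
  rewrite (metricC dX); have [_ _ Vab] := Dab; have [_ _ _ /(_ s) Vg] := gP _ Vab.
  by have [_ _ /(_ _ Vg)] := VP ab.1.
Qed.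

Hypothesis X_connected : connected [set: X].

(** Otherwise the set of points reachable from [x] within the [e]-ball would stay within [e / 2],
    hence be clopen, and so contain [z]. *)
Lemma joined_escape x z e : 0 < e -> e <= d x z ->
  exists2 y, joined R [set y | d x y < e] x y & e / 2 <= d x y.
Proof.
move=> e0 xz; apply: contrapT => no.
pose C := [set y | joined R [set y | d x y < e] x y].
have Cx : C x by apply: joined_refl; rewrite /= (metric_xx dX).
have Ce y : C y -> d x y < e / 2.
  by move=> Cy; rewrite ltNge; apply/negP => ye; apply: no; exists y.
have step y : d x y < e -> exists V : set X,
    [/\ open V, V y & V `&` C !=set0 -> V `<=` C].
  move=> xy; have [V [oV Vy Ve Vp]] := @path_nbhd y (e - d x y) ltac:(lra).
  exists V; split => // -[c [Vc Cc]] v Vv; apply: joined_trans Cc _.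
  apply: joined_sub (path_connected_joined Vp Vc Vv) => w /Ve /= yw.
  by have := metric_tri dX x y w; lra.
have : C = [set: X].
  apply: X_connected; first by exists x.
    exists C; last by rewrite setTI.
    rewrite openE => y Cy; have [|V [oV Vy VC]] := step y.
      by have := Ce y Cy; lra.
    apply: filterS (open_nbhs_nbhs (conj oV Vy)); apply: VC; by exists y.
  exists C; last by rewrite setTI.
  move=> y yC; have e20 : 0 < e / 2 by lra.
  have [c [Cc /= yc]] := yC _ (near_metric dX y e20).
  have [|V [oV Vy VC]] := step y.
    by have := Ce c Cc; have := metric_tri dX x c y; rewrite (metricC dX c y); lra.
  apply: (VC _ y Vy); have [w [Cw Vw]] := yC _ (open_nbhs_nbhs (conj oV Vy)).
  by exists w.
move=> CT; have Cz : C z by rewrite CT.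
by have := Ce z Cz; lra.
Qed.

(* The added points lie at the distances [e / 4 * 2 ^- k] from a single point,
   hence at mutual distances that do not depend on [M]. *)
Lemma Fin_joined_spread (A : Fin X) e M : 0 < e ->
  (forall x, exists z, e <= d x z) ->
  exists2 P : Fin X, joined R [set C | H A C < e] A P &
    exists x (z : nat -> X), forall k, (k <= M)%N ->
      Fin_set P (z k) /\ d x (z k) = e / 4 * 2 ^- k.
Proof.
move=> e0 far; have [x Ax] := Fin_set_neq0 A; have [z xz] := far x.
(* With radius [e / 2] the path ends at distance at least [e / 4], so it passes through every
   distance [e / 4 * 2 ^- k]. *)
have [||_ [p [cp p0 <- pe]] p1] := @joined_escape x z (e / 2); [lra|lra|].
have dp : continuous (fun s => d x (p s)).
  apply: (@comp_continuous _ _ _ p (d x)) => //; apply: (lipschitz1_continuous dX).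
  by move=> y y'; rewrite (metricC dX y); exact: metric_tri.
have sP k : exists s, d x (p s) = e / 4 * 2 ^- k.
  have k0 : 0 < 2 ^- k :> R by rewrite invr_gt0 exprn_gt0.
  have k1 : 2 ^- k <= 1 :> R by rewrite invf_le1 ?exprn_gt0// exprn_ege1//; lra.
  have [||s _ sE] := @IVT R (fun s => d x (p s)) 0 1 (e / 4 * 2 ^- k) ler01.
  - exact: continuous_subspaceT.
  - rewrite p0 (metric_xx dX) min_l ?max_r ?(metric_ge0 dX)//.
    by apply/andP; split; nra.
  - by exists s.
have [s sE] := choice sP.
(* Indices [inl a] keep [A] fixed, while [inr k] carries a copy of [x] along [p] up to the parameter
   [s k]. *)
pose g (j : X + nat) u := match j with inl a => a | inr k => p (u * s k) end.
pose D := [set j : X + nat |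
  match j with inl a => Fin_set A a | inr k => (k <= M)%N end].
have finD : finite_set D.
  apply: (@sub_finite_set _ _ ((inl @` Fin_set A) `|` (inr @` `I_M.+1))).
    by move=> [a|k] jD; [left; exists a|right; exists k].
  rewrite finite_setU; split; apply: finite_image; last exact: finite_II.
  exact: Fin_set_finite.
have finP u : finite_set [set g j u | j in D] /\ [set g j u | j in D] !=set0.
  by split; [exact: finite_image|exists x, (inl x)].
have ends : (mkFin (finP 0)) = A.
  apply/Fin_set_inj/seteqP; split => [_ [[a|k] jD <-] //|a Aa]; last by exists (inl a).
  by rewrite /= mul0r p0.
exists (mkFin (finP 1)).
  exists (fun u => mkFin (finP u)); split => //.
    apply: (@finite_family_continuous X _ _ D g) => // -[a|k] _ /=.
      exact: cst_continuous.
    apply: (@comp_continuous _ _ _ (fun u : R => u * s k) p) => //.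
    exact: mulrr_continuous.
  move=> u; apply/(Hausdorff_metric_ltP dX); split => //.
    by move=> a Aa; exists a; [exists (inl a)|rewrite (metric_xx dX)].
  move=> _ [[a|k] jD <-]; first by exists a => //; rewrite (metric_xx dX).
  exists x => //; rewrite (metricC dX); have /= := pe (u * s k); lra.
exists x, (p \o s) => k kM; split; last exact: sE.
by exists (inr k) => //=; rewrite mul1r.
Qed.

End FinGeometry.

(** A Lebesgue function: half the supremum of the radii up to [c] whose ball fits into a member of
    [U]. It is halved because the supremum need not be attained. *)
Lemma open_cover_radius (R : realType) (T : topologicalType) (d : T -> T -> R)
    (U : set (set T)) (c : R) : compatible_metric d -> open_cover U -> 0 < c ->
  exists e : T -> R, [/\ forall x, 0 < e x <= c,
    forall x y, e x <= e y + d x y &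
    forall x, exists2 V, U V & [set y | d x y < e x] `<=` V].
Proof.
move=> dT [oU UT] c0.
pose S x := [set r | r <= c /\ exists2 V, U V & [set y | d x y < r] `<=` V].
have Sub x : has_ubound (S x) by exists c => r [].
have Spos x : exists2 r, 0 < r & S x r.
  have [V UV Vx] : cover U id x by rewrite UT.
  have [e e0 eV] := nbhs_metric dT (open_nbhs_nbhs (conj (oU _ UV) Vx)).
  exists (Num.min e c); first by rewrite lt_min e0.
  split; first by rewrite ge_min lexx orbT.
  by exists V => // y /=; rewrite lt_min => /andP[/eV].
have S0 x : S x !=set0 by have [r _ Sr] := Spos x; exists r.
have sup_gt0 x : 0 < sup (S x).
  by have [r r0 Sr] := Spos x; apply: lt_le_trans r0 _; exact: ub_le_sup.
exists (fun x => sup (S x) / 2); split.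
- move=> x; rewrite divr_gt0//=.
  have : sup (S x) <= c by apply: ge_sup => // r [].
  by have := sup_gt0 x; lra.
- move=> x y; have : sup (S x) <= sup (S y) + d x y.
    apply: ge_sup => // r [rc [V UV xV]]; rewrite -lerBlDr; apply: ub_le_sup => //.
    split; first by have := metric_ge0 dT x y; lra.
    exists V => // z /= yz; apply: xV => /=.
    by have := metric_tri dT x y z; lra.
  by have := metric_ge0 dT x y; lra.
- move=> x; have /sup_gt : sup (S x) / 2 < sup (S x) by have := sup_gt0 x; lra.
  move=> [//|r [_ [V UV xV]] xr]; exists V => // y /= xy.
  by apply: xV => /=; exact: lt_trans xr.
Qed.

(** * Covering numbers on compact sets and approximation of the identity *)

Section FinApproximation.
Context (R : realType) (X : topologicalType) (d : X -> X -> R).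
Hypothesis dX : compatible_metric d.
Local Notation H := (Hausdorff_metric d).

(** The points of [A] serve as centres for all [B] near [A], so the number of centres is locally
    bounded, hence bounded on [K]. *)
Lemma compact_covered_by_balls (K : set (Fin X)) (e : Fin X -> R)
    (w : nat -> R) : compact K -> (forall A, 0 < e A) ->
  (forall A B, e A <= e B + H A B) -> (forall n, 0 < w n <= 1) ->
  exists M, forall B, K B -> exists s : seq X, (size s <= M)%N /\
    forall b, Fin_set B b -> exists2 a, a \in s & d b a < w (size s) * e B.
Proof.
move=> cK e0 e_lip w01.
pose Q M B := exists s : seq X, (size s <= M)%N /\
    forall b, Fin_set B b -> exists2 a, a \in s & d b a < w (size s) * e B.
suff : \forall M \near \oo, K `<=` Q M.
  by move=> [M _ KM]; exists M; apply: KM; rewrite /= leqnn.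
have /compact_near_coveringP := cK; apply => A _.
have /finite_seqP[s As] := Fin_set_finite A.
have /andP[w0 w1] := w01 (size s); have eA := e0 A.
have r0 : 0 < w (size s) * e A / 2 by rewrite divr_gt0// mulr_gt0.
(* So close to [A], [e B] is at least [e A / 2], and the radius does not exceed the one allowed for
   [B]. *)
exists ([set B | H A B < w (size s) * e A / 2], [set M | (size s <= M)%N]) => /=.
  split; first exact: (near_metric (Hausdorff_compatible dX) A r0).
  exact: nbhs_infty_ge.
move=> [B M] /= [AB sM]; exists s; split => // b Bb.
have /(Hausdorff_metric_ltP dX)[_ _ /(_ b Bb)[a Aa ba]] := AB.
exists a; first by rewrite As in Aa.
apply: lt_le_trans ba _; have := e_lip A B; nra.
Qed.

Section Approximation.
Variables (e : Fin X -> R) (P : Fin X -> Fin X).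
Hypothesis e_gt0 : forall A, 0 < e A.
Hypothesis e_lip : forall A B, e A <= e B + H A B.
Hypothesis P_joined : forall A, joined R [set B | H A B < e A / 8] A (P A).
Hypothesis X_lpc : locally_path_connected R X.

Lemma Fin_approximation : exists f : Fin X -> Fin X, [/\ continuous f,
  forall A, H A (f A) < e A / 2 &
  forall A, exists2 C, H C A < e C / 16 & Fin_set (P C) `<=` Fin_set (f A)].
Proof.
have dH := Hausdorff_compatible dX.
have /choice[rho rhoP] : forall A, exists r : R, 0 < r /\
    [set B | H A B < r] `<=` [set B | joined R [set C | H A C < e A / 8] A B].
  move=> A; have e80 : 0 < e A / 8 by have := e_gt0 A; lra.
  by have [r r0 rP] := nbhs_metric dH (Fin_near_joined dX X_lpc A e80); exists r.
(* Centres of overlapping pieces are less than twice the larger [r] apart, hence joinable by the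
   choice of [rho / 2]; [e / 16] keeps [e] nearly constant on a piece. *)
pose r A := Num.min (rho A / 2) (e A / 16).
have r0 A : 0 < r A.
  by have [? _] := rhoP A; rewrite lt_min !divr_gt0.
have re A : r A <= e A / 16 by rewrite ge_min lexx orbT.
(* One path is chosen per pair of pieces, so it has to be close to every [A] common to both. *)
pose G C D := [set B | forall A, H C A < r C -> H D A < r D -> H A B < e A / 2].
have GC C D : G C D `<=` G D C by move=> B CD A DA CA; exact: CD.
have joinG C D A : r D <= r C -> H C A < r C -> H D A < r D ->
    joined R (G C D) (P C) (P D).
  move=> DC CA DA; have CD : H C D < 2 * r C.
    by have := metric_tri dH C A D; rewrite (metricC dH A D); lra.
  have CDj : joined R [set B | H C B < e C / 8] C D.
    have [_] := rhoP C; apply; apply: lt_le_trans CD _.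
    have rC : r C <= rho C / 2 by rewrite ge_min lexx.
    by lra.
  (* The path runs from [P C] through [C] and [D] to [P D]. The last leg goes farthest from [C]: up
     to [e C] times 1/8 + 9/64 = 17/64, just below 27/100. *)
  apply: (@joined_sub _ _ [set B | H C B < e C * (27 / 100)]).
    move=> B /= CB A' CA' _; have := e_lip C A'; have := re C.
    have := metric_tri dH A' C B; rewrite (metricC dH A' C); have := e_gt0 C; lra.
  have eC := e_gt0 C.
  apply: (@joined_trans _ _ _ _ C).
    by apply: joined_sym; apply: joined_sub (P_joined C) => B /=; lra.
  apply: (@joined_trans _ _ _ _ D).
    by apply: joined_sub CDj => B /=; lra.
  apply: joined_sub (P_joined D) => B /= DB; have := metric_tri dH C D B.
  by have := e_lip D C; have := re C; rewrite (metricC dH D C); lra.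
have [t [t_cts tr t_max t_fin]] := metric_partition dH r0.
have /choice[p pP] : forall ik : (nat * Fin X) * (nat * Fin X),
    exists p : R -> Fin X, continuous p /\
    forall A, 4^-1 <= t ik.1 A -> 4^-1 <= t ik.2 A ->
    [/\ p 0 = P ik.1.2, p 1 = P ik.2.2 & forall s, H A (p s) < e A / 2].
  move=> [i k] /=; have [[A [iA kA]]|no] :=
    pselect (exists A, 4^-1 <= t i A /\ 4^-1 <= t k A); last first.
    exists (fun=> P i.2); split; first exact: cst_continuous.
    by move=> A iA kA; case: no; exists A.
  have /tr CA := iA; have /tr DA := kA.
  have [p [cp p0 p1 pG]] : joined R (G i.2 k.2) (P i.2) (P k.2).
    have [DC|CD] := leP (r k.2) (r i.2); first exact: (joinG _ _ A).
    by apply/joined_sym/(joined_sub (@GC _ _))/(joinG _ _ A) => //; exact: ltW.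
  by exists p; split => // A' /tr CA' /tr DA'; split => // s; exact: pG.
have [||f [cf fP fp]] := @nerve_map R X _ _ t t_cts t_max t_fin
    (P \o snd) (fun i k => p (i, k)).
- by move=> i k; case: (pP (i, k)).
- by move=> i k A iA kA; have [_ /(_ A iA kA)[]] := pP (i, k).
exists f; split => // A.
- apply/(Hausdorff_metric_ltP dX); split; first by have := e_gt0 A; lra.
  + move=> a Aa; have [i iA] := t_max A; have iA4 : 4^-1 <= t i A by rewrite iA; lra.
    have [_ /(_ A iA4 iA4)[p0 _ /(_ 0)]] := pP (i, i).
    rewrite p0 => /(Hausdorff_metric_ltP dX)[_ /(_ a Aa)[b Pb ab] _].
    by exists b => //; exact: (fP A i iA).
  + move=> b /fp[i [k [s [iA kA pb]]]].
    have [_ /(_ A iA kA)[_ _ /(_ s)]] := pP (i, k).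
    by move=> /(Hausdorff_metric_ltP dX)[_ _]; apply.
- have [i iA] := t_max A; exists i.2; last exact: (fP A i iA).
  by apply: lt_le_trans (re i.2); apply: tr; rewrite iA; lra.
Qed.

End Approximation.

End FinApproximation.

(** * Counting separated points against covering balls *)

Theorem theorem1 (R : realType) (X : topologicalType)
    (X_metrizable : metrizable R X)
    (X_nondegenerate : nondegenerate_space X)
    (X_connected : connected [set: X])
    (X_locally_path_connected : locally_path_connected R X) :
  compact_strong_Z_set_property (Fin X).
Proof.
move=> K cK; have [d dX] := X_metrizable.
have dH := Hausdorff_compatible dX; set H := Hausdorff_metric d in dH.
split; first by apply: compact_closed cK; exact: compatible_metric_hausdorff dH.
move=> U UX; have [p [q pq]] := X_nondegenerate.
have dpq : 0 < d p q.
  by rewrite lt_neqAle (metric_ge0 dX) andbT; apply/eqP => /esym/(metric_eq0 dX).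
have far x : exists z, d p q / 2 <= d x z.
  have [xp|xp] := leP (d p q / 2) (d x p); first by exists p.
  by exists q; have := metric_tri dX p x q; rewrite (metricC dX p x); lra.
(* The bound [d p q / 2] on [e] ensures that every point has another one at distance at least
   [e A / 8], as the spreading requires. *)
have [|e [e_bnd e_lip eU]] := open_cover_radius (c := d p q / 2) dH UX; first lra.
have e_gt0 A : 0 < e A by case/andP: (e_bnd A).
have pow_gt0 n : 0 < 2 ^- n :> R by rewrite invr_gt0 exprn_gt0.
have pow_le1 n : 2 ^- n <= 1 :> R by rewrite invf_le1 ?exprn_gt0// exprn_ege1//; lra.
(* Why 512: spread points sharing a centre would be less than [4 * tau], at most
   [2 ^- m * e C / 64], apart, whereas their distances to [x] differ by at least
   [2 ^- m * e C / 32]. *)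
have w01 n : 0 < (2 ^- n / 512 : R) <= 1.
  by have := pow_gt0 n; have := pow_le1 n => ? ?; apply/andP; split; lra.
(* [M] comes from [K] and [e] alone, before [P] and [f] are chosen. *)
have [M KM] := compact_covered_by_balls dX cK e_gt0 e_lip w01.
have /choice[P PP] : forall A, exists P : Fin X,
    joined R [set B | H A B < e A / 8] A P /\
    exists x (z : nat -> X), forall k, (k <= M)%N ->
      Fin_set P (z k) /\ d x (z k) = e A / 8 / 4 * 2 ^- k.
  move=> A; have [||P AP Pz] := @Fin_joined_spread R X d dX X_locally_path_connected
      X_connected A (e A / 8) M.
  - by have := e_gt0 A; lra.
  - move=> x; have [z xz] := far x; exists z; apply: le_trans xz.
    by have /andP[_] := e_bnd A; have := e_gt0 A; lra.
  - by exists P.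
have [f [cf fe fP]] := Fin_approximation dX e_gt0 e_lip (fun A => (PP A).1)
  X_locally_path_connected.
exists f; split => // [A|].
  have [V UV eV] := eU A; exists V => //; split; apply: eV => /=.
    by apply: lt_trans (fe A) _; have := e_gt0 A; lra.
  by rewrite (metric_xx dH).
apply/seteqP; split => // B [Bf KB].
have [s [sM Bs]] := KM B KB; set m := size s in sM Bs.
have /andP[w0 w1] := w01 m.
set tau := 2 ^- m / 512 * e B in Bs.
have tau0 : 0 < tau by rewrite mulr_gt0.
have [_ [[A _ <-] /= BfA]] := Bf _ (near_metric dH B tau0).
have [C CA PC] := fP A.
have [_ [x [z zP]]] := PP C.
(* [e] changes little along the chain [B], [f A], [A], [C]. *)
have eBC : e B <= 2 * e C.
  have m1 := pow_le1 m.
  have tauB : tau <= e B / 512 by rewrite /tau; have := e_gt0 B; nra.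
  have := e_lip B (f A); have := e_lip (f A) A; have := e_lip A C.
  have := fe A; rewrite (metricC dH (f A)) (metricC dH A C) -/H; have := e_gt0 A; lra.
(* Each of the [m + 1] points [z 0] to [z m] gets a centre from the list [s] of length [m]; [p] is a
   dummy for larger indices. *)
have /choice[a aP] : forall k, exists a, (k <= m)%N -> a \in s /\ d (z k) a < 2 * tau.
  move=> k; have [km|km] := leqP k m; last by exists p.
  have [Pz _] := zP k (leq_trans km sM).
  have /(Hausdorff_metric_ltP dX)[_ _ /(_ _ (PC _ Pz))[b Bb zb]] := BfA.
  have [c cs bc] := Bs b Bb; exists c => _; split => //.
  by have := metric_tri dX (z k) b c; lra.
have a_neq j k : (j < k <= m)%N -> a j <> a k.
  move=> /andP[jk km] ajk.
  have jm : (j <= m)%N by apply: leq_trans km; exact: ltnW.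
  have [_ zj] := aP j jm; have [_ zk] := aP k km.
  have [_ xj] := zP j (leq_trans jm sM); have [_ xk] := zP k (leq_trans km sM).
  have := metric_tri dX x (z k) (z j); have := metric_tri dX (z k) (a k) (z j).
  rewrite -ajk in zk *; rewrite (metricC dX (a j)) xj xk.
  have pow (i l : nat) : (i <= l)%N -> 2 ^- l <= 2 ^- i :> R.
    by move=> il; rewrite lef_pV2 ?posrE ?exprn_gt0// ler_weXn2l//; lra.
  have h1 := pow _ _ km; have := pow _ _ jk; rewrite exprS invfM => h2.
  have h3 := pow_gt0 m.
  have eC := e_gt0 C; have tauC : tau <= 2 ^- m / 512 * (2 * e C).
    by rewrite ler_pM2l.
  have h4 : e C * 2 ^- m <= e C * 2 ^- k by rewrite ler_pM2l.
  have h5 : e C * (2^-1 * 2 ^- j) >= e C * 2 ^- k by rewrite ler_pM2l; lra.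
  have := mulr_gt0 eC h3; lra.
have a_inj : {in iota 0 m.+1 &, injective a}.
  move=> j k; rewrite !mem_iota /= !add0n !ltnS => jm km ajk.
  have [jk|jk|//] := ltngtP j k.
  - by case: (@a_neq j k) => //; rewrite jk.
  - by case: (@a_neq k j) => //; rewrite jk.
suff : (m < m)%N by rewrite ltnn.
rewrite -[m.+1](size_iota 0) -(size_map a); apply: uniq_leq_size.
  by rewrite map_inj_in_uniq// iota_uniq.
by move=> y /mapP[k]; rewrite mem_iota add0n ltnS => km ->; case: (aP k km).
Qed.
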